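(* Let $\gamma>0$, $\Delta t>0$, and let $u^n=(u_1^n,\ldots,u_{N_h}^n)$ be given cell averages with bounds $u_i^{\min},u_i^{\max}$ satisfying $$u_i^{\min}\le\min_{j\in\mathcal V_i}u^n_j\le\max_{j\in\mathcal V_i}u^n_j\le u_i^{\max},\qquad i=1,\ldots,N_h.$$ Let $H_{ij}^{\rm FE}=H(u_i^n,u_j^n,\mathbf n_{ij})$ be the low-order Lax-Friedrichs fluxes, let $H_{ij}^{\rm RK}$ be the final-stage fluxes of an explicit $M$-stage Runge-Kutta method, let $F_{ij}^{\rm RK}=|S_{ij}|(H_{ij}^{\rm FE}-H_{ij}^{\rm RK})$, and define the flux-limited final stage $$u_i^{n+1}=u_i^n-\frac{\Delta t}{|K_i|}\sum_{j\in\mathcal N_i}|S_{ij}|\left[\alpha_{ij}H_{ij}^{\rm RK}+(1-\alpha_{ij})H_{ij}^{\rm FE}\right],$$ where the correction factors $\alpha_{ij}$ are calculated by the GMC (global monolithic convex) limiter with parameter $\gamma$ applied to the fluxes $F_{ij}^{\rm RK}$. If $$(1+\gamma)\frac{\Delta t\,d_i}{|K_i|}\le 1,\qquad i=1,\ldots,N_h,$$ then $u_i^{\min}\le u_i^{n+1}\le u_i^{\max}$ for all $i=1,\ldots,N_h$.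
   Context: The scheme discretizes the scalar conservation law $\partial_t u+\nabla\cdot\mathbf f(u)=0$ with (continuously differentiable) flux $\mathbf f:\mathbb R\to\mathbb R^d$, $d\in\{1,2,3\}$, on a hyperrectangle with periodic boundary conditions, partitioned into finitely many cells $K_1,\ldots,K_{N_h}$ of volume $|K_i|>0$. $\mathcal N_i$ is the (nonempty) set of indices $j\ne i$ of cells sharing a face $S_{ij}=\partial K_i\cap\partial K_j$ of positive area $|S_{ij}|$ with $K_i$; $\mathbf n_{ij}=-\mathbf n_{ji}$ is the constant unit normal on $S_{ij}$ pointing out of $K_i$, and $\sum_{j\in\mathcal N_i}|S_{ij}|\mathbf n_{ij}=0$. $\mathcal V_i$ is the set containing $i$ and the indices of all cells that share a vertex with $K_i$ (so $\mathcal N_i\subset\mathcal V_i$). $\lambda_{ij}=\lambda_{ji}>0$ is an upper bound for the wave speed of the Riemann problem associated with $S_{ij}$, i.e. $|\mathbf f'(v)\cdot\mathbf n_{ij}|\le\lambda_{ij}$ for all $v$ between $u_i^n$ and $u_j^n$. The Lax-Friedrichs flux is $H(v,w,\mathbf n_{ij})=\frac{\mathbf f(w)+\mathbf f(v)}2\cdot\mathbf n_{ij}-\frac{\lambda_{ij}}2(w-v)$. Set $$\bar u_{ij}^L=\frac{u_j^n+u_i^n}{2}-\frac{\mathbf f(u_j^n)-\mathbf f(u_i^n)}{2\lambda_{ij}}\cdot\mathbf n_{ij},\qquad d_i=\sum_{j\in\mathcal N_i}|S_{ij}|\lambda_{ij},\qquad \bar u_i^L=\frac1{d_i}\sum_{j\in\mathcal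 N_i}|S_{ij}|\lambda_{ij}\bar u_{ij}^L.$$ The Runge-Kutta method has coefficients $a_{ms}$, $b_m$. Its stages are $y_i^{(1)}=u_i^n$ and $y_i^{(m)}=u_i^n-\frac{\Delta t}{|K_i|}\sum_{j\in\mathcal N_i}|S_{ij}|\sum_{s=1}^{m-1}a_{ms}H_{ij}^*(\hat y^{(s)})$ for $m=2,\ldots,M$, and $H_{ij}^{\rm RK}=\sum_{m=1}^M b_mH_{ij}^*(\hat y^{(m)})$. Here $\hat y^{(m)}$ is a piecewise-polynomial reconstruction from the cell averages $y_i^{(m)}$ and $H_{ij}^*(\hat y)=H(y_i,y_j,\mathbf n_{ij})-F_{ij}^*(\hat y)/|S_{ij}|$, where $F_{ij}^*=-F_{ji}^*$ are (unlimited or limited) antidiffusive fluxes; the unlimited ones are $F_{ij}=\int_{S_{ij}}[H(y_i,y_j,\mathbf n_{ij})-H(\hat y_i,\hat y_j,\mathbf n_{ij})]\,\mathrm ds$. In particular $H_{ji}^{\rm RK}=-H_{ij}^{\rm RK}$ and $F_{ji}^{\rm RK}=-F_{ij}^{\rm RK}$. No bound-preserving property of the stages is assumed. GMC limiter applied to fluxes $F_{ij}=F_{ij}^{\rm RK}$: set $$Q_i^-=d_i[(u_i^{\min}-\bar u_i^L)+\gamma(u_i^{\min}-u_i^n)],\quad Q_i^+=d_i[(u_i^{\max}-\bar u_i^L)+\gamma(u_i^{\max}-u_i^n)],$$ $$P_i^+=\sum_{j\in\mathcal N_i}\max\{0,F_{ij}\},\quad P_i^-=\sum_{j\in\mathcal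 N_i}\min\{0,F_{ij}\},\quad R_i^\pm=\min\{1,Q_i^\pm/P_i^\pm\}$$ (with $R_i^\pm=1$ if $P_i^\pm=0$), and $\alpha_{ij}=\min\{R_i^+,R_j^-\}$ if $F_{ij}>0$, $\alpha_{ij}=1$ if $F_{ij}=0$, $\alpha_{ij}=\min\{R_i^-,R_j^+\}$ if $F_{ij}<0$. *)

(* Defs.v *)
From mathcomp Require Import all_boot all_order all_algebra.
From mathcomp Require mpoly.
From mathcomp Require Import all_classical all_reals all_analysis.
Import Order.TTheory GRing.Theory Num.Theory.
Import numFieldNormedType.Exports.

Set Implicit Arguments.
Unset Strict Implicit.
Unset Printing Implicit Defensive.

Local Open Scope ring_scope.

Definition dot (R : realType) (d : nat) (x y : 'rV[R]_d) : R :=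
  \sum_(k < d) x 0 k * y 0 k.

Definition C1 (R : realType) (d : nat) (f : R -> 'rV[R]_d) : Prop :=
  (forall v : R, derivable f v 1) /\ continuous (derive1 f).

(** * Finite-volume meshes *)

(* The data through which a partition of a periodic hyperrectangle in R^d into
   cells K_0, ..., K_(N-1) enters the scheme.  Periodic identification is part
   of the data: faces and vertices that coincide modulo the periods are one
   and the same face or vertex. *)
Record mesh (R : realType) (d N : nat) := Mesh {
  vertex : finType;
  vertices : 'I_N -> {set vertex};         (* vertices of K_i *)
  vol : 'I_N -> R;                         (* |K_i| *)
  area : 'I_N -> 'I_N -> R;                (* |S_ij|; 0 if no common face *)
  normal : 'I_N -> 'I_N -> 'rV[R]_d        (* n_ij; unused if |S_ij| = 0 *)
}.

Section MeshNotions.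
Variables (R : realType) (d N : nat) (K : mesh R d N).

(* N_i *)
Definition nbrs (i : 'I_N) : {set 'I_N} :=
  [set j | (j != i) && (0 < area K i j)].

(* V_i *)
Definition vnbrs (i : 'I_N) : {set 'I_N} :=
  [set j | (j == i) || (vertices K i :&: vertices K j != finset.set0)].

Record is_mesh : Prop := IsMesh {
  vol_gt0 : forall i, 0 < vol K i;
  area_ge0 : forall i j, 0 <= area K i j;
  area_sym : forall i j, area K i j = area K j i;
  nbrs_nonempty : forall i, exists j, j \in nbrs i;
  nbrs_sub_vnbrs : forall i, nbrs i \subset vnbrs i;
  normal_unit : forall i j, j \in nbrs i -> dot (normal K i j) (normal K i j) = 1;
  normal_anti : forall i j, j \in nbrs i -> normal K i j = - normal K j i;
  normal_closed : forall i, \sum_(j in nbrs i) area K i j *: normal K i j = 0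
}.

(* Seeding the iterated minimum with u i is harmless because i \in vnbrs i. *)
Definition local_min (u : 'I_N -> R) (i : 'I_N) : R :=
  \big[Num.min/u i]_(j in vnbrs i) u j.

Definition local_max (u : 'I_N -> R) (i : 'I_N) : R :=
  \big[Num.max/u i]_(j in vnbrs i) u j.

(** * Lax-Friedrichs fluxes *)

Variables (f : R -> 'rV[R]_d) (lam : 'I_N -> 'I_N -> R).

Definition is_wave_speed_bound (u : 'I_N -> R) : Prop :=
  forall i j, j \in nbrs i ->
    [/\ lam i j = lam j i, 0 < lam i j &
      forall v : R, Num.min (u i) (u j) <= v <= Num.max (u i) (u j) ->
        `|dot (derive1 f v) (normal K i j)| <= lam i j].

(* H(v, w, n_ij) *)
Definition LF (i j : 'I_N) (v w : R) : R :=
  dot (2^-1 *: (f w + f v)) (normal K i j) - lam i j / 2 * (w - v).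

(* H_ij^FE *)
Definition HFE (u : 'I_N -> R) (i j : 'I_N) : R := LF i j (u i) (u j).

Definition ubarL_face (u : 'I_N -> R) (i j : 'I_N) : R :=
  (u j + u i) / 2 - dot ((2 * lam i j)^-1 *: (f (u j) - f (u i))) (normal K i j).

Definition dcoef (i : 'I_N) : R := \sum_(j in nbrs i) area K i j * lam i j.

Definition ubarL (u : 'I_N -> R) (i : 'I_N) : R :=
  (dcoef i)^-1 * \sum_(j in nbrs i) area K i j * lam i j * ubarL_face u i j.

(** * Explicit Runge-Kutta method *)

(* Cell averages, and reconstructions: one polynomial in d variables per cell. *)
Definition averages := 'I_N -> R.
Definition pw_poly := 'I_N -> mpoly.mpoly d R.

(* Antidiffusive fluxes F*_ij of each stage, limited or not, as a function of
   the averages y and of their reconstruction.  Limiters may differ from stage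
   to stage. *)
Definition antidiffusive (M : nat) :=
  'I_M -> averages -> pw_poly -> 'I_N -> 'I_N -> R.

Definition is_antidiffusive (M : nat) (Fs : antidiffusive M) : Prop :=
  forall m y p i j, j \in nbrs i -> Fs m y p i j = - Fs m y p j i.

Variables (M : nat) (recon : averages -> pw_poly) (Fs : antidiffusive M).

(* H*_ij evaluated at the reconstruction of the stage-m averages y *)
Definition Hstar (m : 'I_M) (y : averages) (i j : 'I_N) : R :=
  LF i j (y i) (y j) - Fs m y (recon y) i j / area K i j.

(* Stages are numbered from 0; for m = 0 the sum over s is empty and the
   equation reads y 0 i = u i.  By induction on m, the equations determine y;
   only the strictly lower triangular part of a is used. *)
Definition is_RK_stages (dt : R) (a : 'I_M -> 'I_M -> R) (u : averages)
    (y : 'I_M -> averages) : Prop :=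
  forall (m : 'I_M) (i : 'I_N),
    y m i = u i - dt / vol K i *
      \sum_(j in nbrs i) area K i j *
        \sum_(s < M | (s < m)%N) a m s * Hstar s (y s) i j.

Definition HRK (b : 'I_M -> R) (y : 'I_M -> averages) (i j : 'I_N) : R :=
  \sum_(m < M) b m * Hstar m (y m) i j.

Definition FRK (b : 'I_M -> R) (u : averages) (y : 'I_M -> averages)
    (i j : 'I_N) : R :=
  area K i j * (HFE u i j - HRK b y i j).

(** * GMC limiter *)

Section GMC.
Variables (gamma : R) (u umin umax : averages) (F : 'I_N -> 'I_N -> R).

Definition Qminus (i : 'I_N) : R :=
  dcoef i * ((umin i - ubarL u i) + gamma * (umin i - u i)).
Definition Qplus (i : 'I_N) : R :=
  dcoef i * ((umax i - ubarL u i) + gamma * (umax i - u i)).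

Definition Pplus (i : 'I_N) : R := \sum_(j in nbrs i) Num.max 0 (F i j).
Definition Pminus (i : 'I_N) : R := \sum_(j in nbrs i) Num.min 0 (F i j).

Definition Rplus (i : 'I_N) : R :=
  if Pplus i == 0 then 1 else Num.min 1 (Qplus i / Pplus i).
Definition Rminus (i : 'I_N) : R :=
  if Pminus i == 0 then 1 else Num.min 1 (Qminus i / Pminus i).

Definition alphaGMC (i j : 'I_N) : R :=
  if 0 < F i j then Num.min (Rplus i) (Rminus j)
  else if F i j == 0 then 1
  else Num.min (Rminus i) (Rplus j).

End GMC.

(* u^{n+1} *)
Definition limited_final_stage (dt gamma : R) (b : 'I_M -> R)
    (u umin umax : averages) (y : 'I_M -> averages) (i : 'I_N) : R :=
  u i - dt / vol K i *
    \sum_(j in nbrs i) area K i j *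
      (alphaGMC gamma u umin umax (FRK b u y) i j * HRK b y i j
       + (1 - alphaGMC gamma u umin umax (FRK b u y) i j) * HFE u i j).

End MeshNotions.

(* Main.v *)
(** Closedness of the cell boundaries turns the low-order update into
    u_i + dt d_i / |K_i| (ubar_i^L - u_i), so that the limited final stage is
    u_i + dt / |K_i| (d_i (ubar_i^L - u_i) + sum_j alpha_ij F_ij).
    By the mean value theorem and the wave speed bound, every bar state lies
    between u_i and u_j, hence Q_i^- <= 0 <= Q_i^+.  Then alpha_ij >= 0, and the
    limiter gives Q_i^- <= sum_j alpha_ij F_ij <= Q_i^+.  Inserting Q_i^+ yields
    u_i^{n+1} <= u_i + (1 + gamma) dt d_i / |K_i| (u_i^max - u_i), which is at
    most u_i^max by the CFL condition; likewise for the lower bound. *)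
Require Import Defs.
From mathcomp Require Import all_boot all_order all_algebra.
From mathcomp Require Import all_classical all_reals all_analysis.
From mathcomp Require Import ring lra.
Import Order.TTheory GRing.Theory Num.Theory.
Import numFieldNormedType.Exports.
Local Open Scope ring_scope.

(** * Linearity of the dot product *)

Lemma dotDl (R : realType) (d : nat) (x y z : 'rV[R]_d) :
  dot (x + y) z = dot x z + dot y z.
Proof.
by rewrite /dot -big_split; apply: eq_bigr => k _; rewrite mxE mulrDl.
Qed.

Lemma dotZl (R : realType) (d : nat) (c : R) (x y : 'rV[R]_d) :
  dot (c *: x) y = c * dot x y.
Proof. by rewrite /dot mulr_sumr; apply: eq_bigr => k _; rewrite mxE mulrA. Qed.

Lemma dotBl (R : realType) (d : nat) (x y z : 'rV[R]_d) :
  dot (x - y) z = dot x z - dot y z.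
Proof. by rewrite dotDl -scaleN1r dotZl mulN1r. Qed.

Lemma dotZr (R : realType) (d : nat) (c : R) (x y : 'rV[R]_d) :
  dot x (c *: y) = c * dot x y.
Proof. by rewrite /dot mulr_sumr; apply: eq_bigr => k _; rewrite mxE; ring. Qed.

Lemma dot_sumr (R : realType) (d : nat) (I : finType) (P : pred I)
    (x : 'rV[R]_d) (y : I -> 'rV[R]_d) :
  dot x (\sum_(i | P i) y i) = \sum_(i | P i) dot x (y i).
Proof.
rewrite /dot exchange_big; apply: eq_bigr => k _.
by rewrite summxE mulr_sumr.
Qed.

(** * Mean value estimate for the normal flux *)

(** Vector derivatives are entrywise, and pairing with a fixed [n] is a linear combination of the
    entries. *)
Lemma is_derive_dot (R : realType) (d : nat) (f : R -> 'rV[R]_d)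
    (n : 'rV[R]_d) (v : R) :
  derivable f v 1 ->
  is_derive v 1 (fun w => dot (f w) n) (dot (derive1 f v) n).
Proof.
move=> df; have /derivable_mxP dfk := df.
have -> : (fun w => dot (f w) n) =
    \sum_(k < d) (n 0 k \*: (fun w => f w 0 k : R^o)).
  by apply/funext => w; rewrite fct_sumE; apply: eq_bigr => k _; rewrite mulrC.
have -> : dot (derive1 f v) n =
    \sum_(k < d) n 0 k *: 'D_1 (fun w => f w 0 k : R^o) v.
  rewrite derive1E derive_mx //; apply: eq_bigr => k _.
  by rewrite mxE mulrC.
by apply: is_derive_sum => k; apply: is_deriveZ; apply/derivableP/dfk.
Qed.

Lemma dot_flux_lipschitz (R : realType) (d : nat) (f : R -> 'rV[R]_d)
    (n : 'rV[R]_d) (L v w : R) :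
  (forall x : R, derivable f x 1) ->
  (forall x : R, Num.min v w <= x <= Num.max v w ->
     `|dot (derive1 f x) n| <= L) ->
  `|dot (f w - f v) n| <= L * `|w - v|.
Proof.
(* Swapping [v] and [w] only flips a sign inside both absolute values and leaves the interval
   between them unchanged. *)
move=> df; wlog vw : v w / v <= w => [H|] bnd.
  case: (leP v w) => [/H|/ltW wv]; first exact.
  rewrite distrC -opprB -scaleN1r dotZl mulN1r normrN; apply: H => // x.
  by rewrite minC maxC; apply: bnd.
have dg (x : R) : is_derive x 1 (fun y => dot (f y) n) (dot (derive1 f x) n).
  exact: is_derive_dot.
have [|c] := MVT_segment vw (fun x _ => dg x).
  by apply: derivable_within_continuous => x _; exact: ex_derive.
rewrite in_itv /= => cvw; rewrite dotBl => ->; rewrite normrM ler_wpM2r //.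
by apply: bnd; rewrite min_l // max_r.
Qed.

(** * Bar states *)

(** The flux difference shifts the midpoint of [u i] and [u j] by at most [|u j - u i| / 2], so the
    bar state stays between the two values. *)
Lemma ubarL_face_bounds (R : realType) (d N : nat) (K : mesh R d N)
    (f : R -> 'rV[R]_d) (lam : 'I_N -> 'I_N -> R) (u : 'I_N -> R)
    (lo hi : R) (i j : 'I_N) :
  (forall x : R, derivable f x 1) -> is_wave_speed_bound K f lam u ->
  j \in nbrs K i -> lo <= u i <= hi -> lo <= u j <= hi ->
  lo <= ubarL_face K f lam u i j <= hi.
Proof.
move=> df hlam ij ui uj; have [_ lam0 bnd] := hlam i j ij.
have := dot_flux_lipschitz _ _ _ _ _ _ _ df bnd.
rewrite /ubarL_face dotZl; set x := dot _ _ => xle.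
have : `|(2 * lam i j)^-1 * x| <= `|u j - u i| / 2.
  rewrite normrM gtr0_norm ?invr_gt0 ?mulr_gt0 //.
  rewrite [leLHS]mulrC ler_pdivrMr ?mulr_gt0 // (le_trans xle) //.
  by rewrite le_eqVlt; apply/orP; left; apply/eqP; field.
rewrite ler_norml; case: (ler0P (u j - u i)) => _; lra.
Qed.

Lemma dcoef_gt0 (R : realType) (d N : nat) (K : mesh R d N)
    (f : R -> 'rV[R]_d) (lam : 'I_N -> 'I_N -> R) (u : 'I_N -> R) (i : 'I_N) :
  is_mesh K -> is_wave_speed_bound K f lam u -> 0 < dcoef K lam i.
Proof.
move=> hK hlam; have [j ij] := nbrs_nonempty hK i.
have pos k : k \in nbrs K i -> 0 < area K i k * lam i k.
  move=> ik; have [_ lam0 _] := hlam i k ik.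
  by move: ik; rewrite inE => /andP[_ ?]; rewrite mulr_gt0.
rewrite /dcoef (bigD1 j) //= ltr_pwDl ?pos // sumr_ge0 // => k /andP[ik _].
exact/ltW/pos.
Qed.

(** [ubarL] is a convex combination of the face bar states, with weights
    [area K i j * lam i j / dcoef K lam i]. *)
Lemma ubarL_bounds (R : realType) (d N : nat) (K : mesh R d N)
    (f : R -> 'rV[R]_d) (lam : 'I_N -> 'I_N -> R) (u : 'I_N -> R)
    (lo hi : R) (i : 'I_N) :
  is_mesh K -> (forall x : R, derivable f x 1) ->
  is_wave_speed_bound K f lam u ->
  (forall j, j \in vnbrs K i -> lo <= u j <= hi) ->
  lo <= ubarL K f lam u i <= hi.
Proof.
move=> hK df hlam hu; have d0 : 0 < dcoef K lam i by exact: dcoef_gt0 hlam.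
have face j : j \in nbrs K i -> lo <= ubarL_face K f lam u i j <= hi.
  move=> ij; apply: ubarL_face_bounds => //; apply: hu; first by rewrite inE eqxx.
  exact: (fintype.subsetP (nbrs_sub_vnbrs hK i)).
have w0 j : j \in nbrs K i -> 0 <= area K i j * lam i j.
  by move=> ij; have [_ /ltW ? _] := hlam i j ij; rewrite mulr_ge0 ?(area_ge0 hK).
rewrite /ubarL mulrC ler_pdivlMr // ler_pdivrMr // /dcoef !mulr_sumr.
apply/andP; split; apply: ler_sum => j ij;
  have /andP[lo_face face_hi] := face j ij.
  by rewrite [leRHS]mulrC ler_wpM2r ?w0.
by rewrite [leLHS]mulrC ler_wpM2r ?w0.
Qed.

(** Each flux splits as [lam i j * (u i - ubarL_face i j)] plus the normal component of [f (u i)];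
    the latter sums to zero over the closed cell boundary. *)
Lemma sum_area_HFE (R : realType) (d N : nat) (K : mesh R d N)
    (f : R -> 'rV[R]_d) (lam : 'I_N -> 'I_N -> R) (u : 'I_N -> R) (i : 'I_N) :
  is_mesh K -> is_wave_speed_bound K f lam u ->
  \sum_(j in nbrs K i) area K i j * HFE K f lam u i j =
  - (dcoef K lam i * (ubarL K f lam u i - u i)).
Proof.
move=> hK hlam; have d0 : 0 < dcoef K lam i by exact: dcoef_gt0 hlam.
have closed : \sum_(j in nbrs K i) area K i j * dot (f (u i)) (normal K i j) = 0.
  under eq_bigr do rewrite -dotZr.
  rewrite -dot_sumr (normal_closed hK) /dot big1 // => k _.
  by rewrite mxE mulr0.
have HFE_bar j : j \in nbrs K i -> area K i j * HFE K f lam u i j =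
    area K i j * lam i j * u i - area K i j * lam i j * ubarL_face K f lam u i j
    + area K i j * dot (f (u i)) (normal K i j).
  move=> ij; have [_ lam0 _] := hlam i j ij.
  by rewrite /HFE /LF /ubarL_face !dotZl dotDl dotBl; field; rewrite gt_eqF.
rewrite (eq_bigr _ HFE_bar) big_split sumrB /= closed addr0 -mulr_suml.
by rewrite mulrBr /ubarL mulrA divff ?gt_eqF // mul1r opprB.
Qed.

(** * The limiter *)

Lemma capped_ratio_ge0 (R : realFieldType) (P Q : R) :
  0 <= P -> 0 <= Q -> 0 <= (if P == 0 then 1 else Num.min 1 (Q / P)).
Proof. by move=> P0 Q0; case: ifP => // _; rewrite le_min ler01 divr_ge0. Qed.

(** The cap by [Q / P] is what keeps the limited sum below [Q]; at [P = 0] the default 1 is harmless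
    since the product vanishes. *)
Lemma capped_ratioM_le (R : realFieldType) (P Q : R) :
  0 <= P -> 0 <= Q -> (if P == 0 then 1 else Num.min 1 (Q / P)) * P <= Q.
Proof.
move=> P0 Q0; case: eqVneq => [->|Pn0]; first by rewrite mulr0.
by rewrite -ler_pdivlMr ?lt_def ?Pn0 // ge_min lexx orbT.
Qed.

Lemma Pplus_ge0 (R : realType) (d N : nat) (K : mesh R d N)
    (F : 'I_N -> 'I_N -> R) (i : 'I_N) : 0 <= Pplus K F i.
Proof. by apply: sumr_ge0 => j _; rewrite le_max lexx. Qed.

Lemma Pminus_le0 (R : realType) (d N : nat) (K : mesh R d N)
    (F : 'I_N -> 'I_N -> R) (i : 'I_N) : Pminus K F i <= 0.
Proof. by apply: sumr_le0 => j _; rewrite ge_min lexx. Qed.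

(** Negating both [P] and [Q] leaves the ratio unchanged and makes both nonnegative, so the
    capped-ratio lemmas also serve the lower bound. *)
Lemma RminusE (R : realType) (d N : nat) (K : mesh R d N)
    (f : R -> 'rV[R]_d) (lam : 'I_N -> 'I_N -> R) (gamma : R)
    (u umin : 'I_N -> R) (F : 'I_N -> 'I_N -> R) (i : 'I_N) :
  Rminus K f lam gamma u umin F i =
  if - Pminus K F i == 0 then 1
  else Num.min 1 (- Qminus K f lam gamma u umin i / - Pminus K F i).
Proof. by rewrite /Rminus oppr_eq0 invrN mulrNN. Qed.

(** For the upper bound, negative fluxes contribute at most 0 because their factors are nonnegative,
    and positive ones have factor at most [Rplus i]; the sum is thus at most [Rplus i * Pplus i].
    The lower bound is symmetric. *)
Lemma limited_flux_sum_bounds (R : realType) (d N : nat) (K : mesh R d N)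
    (f : R -> 'rV[R]_d) (lam : 'I_N -> 'I_N -> R) (gamma : R)
    (u umin umax : 'I_N -> R) (F : 'I_N -> 'I_N -> R) :
  (forall i, Qminus K f lam gamma u umin i <= 0) ->
  (forall i, 0 <= Qplus K f lam gamma u umax i) ->
  forall i : 'I_N,
    Qminus K f lam gamma u umin i <=
    \sum_(j in nbrs K i) alphaGMC K f lam gamma u umin umax F i j * F i j <=
    Qplus K f lam gamma u umax i.
Proof.
move=> Qm0 Qp0 i.
have PN0 k : 0 <= - Pminus K F k by rewrite oppr_ge0 Pminus_le0.
have QN0 k : 0 <= - Qminus K f lam gamma u umin k by rewrite oppr_ge0.
have Rp0 k : 0 <= Rplus K f lam gamma u umax F k.
  by rewrite capped_ratio_ge0 ?Pplus_ge0.
have Rm0 k : 0 <= Rminus K f lam gamma u umin F k.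
  by rewrite RminusE capped_ratio_ge0.
apply/andP; split.
  have : Qminus K f lam gamma u umin i <=
      Rminus K f lam gamma u umin F i * Pminus K F i.
    by rewrite -lerN2 -mulrN RminusE capped_ratioM_le.
  move/le_trans; apply; rewrite /Pminus mulr_sumr; apply: ler_sum => j _.
  rewrite /alphaGMC; case: (ltgtP 0 (F i j)) => [F0|F0|<-].
  - by rewrite mulr0 mulr_ge0 ?le_min ?Rp0 ?Rm0 // ltW.
  - by rewrite ler_wnM2r ?ge_min ?lexx // ltW.
  - by rewrite !mulr0.
have : Rplus K f lam gamma u umax F i * Pplus K F i <=
    Qplus K f lam gamma u umax i by rewrite capped_ratioM_le ?Pplus_ge0.
apply: le_trans; rewrite /Pplus mulr_sumr; apply: ler_sum => j _.
rewrite /alphaGMC; case: (ltgtP 0 (F i j)) => [F0|F0|<-].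
- by rewrite ler_wpM2r ?ge_min ?lexx // ltW.
- by rewrite mulr0 mulr_ge0_le0 ?le_min ?Rp0 ?Rm0 // ltW.
- by rewrite !mulr0.
Qed.

(** * The final stage *)

Lemma limited_final_stageE (R : realType) (d N : nat) (K : mesh R d N)
    (f : R -> 'rV[R]_d) (lam : 'I_N -> 'I_N -> R) (M : nat)
    (recon : averages R N -> pw_poly R d N) (Fs : antidiffusive R d N M)
    (dt gamma : R) (b : 'I_M -> R) (u umin umax : averages R N)
    (y : 'I_M -> averages R N) (i : 'I_N) :
  is_mesh K -> is_wave_speed_bound K f lam u ->
  limited_final_stage K f lam recon Fs dt gamma b u umin umax y i =
  u i + dt / vol K i *
    (dcoef K lam i * (ubarL K f lam u i - u i) +
     \sum_(j in nbrs K i)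
       alphaGMC K f lam gamma u umin umax (FRK K f lam recon Fs b u y) i j *
       FRK K f lam recon Fs b u y i j).
Proof.
move=> hK hlam; rewrite /limited_final_stage -mulrN; congr (_ + _ * _).
rewrite -[_ * (ubarL _ _ _ _ _ - _)]opprK -sum_area_HFE // -sumrN -sumrN.
rewrite -big_split; apply: eq_bigr => j _ /=.
(* Only the flux itself is unfolded; the copies inside [alphaGMC] stay folded so that [ring] treats
   the correction factor as an atom. *)
by rewrite {4}/FRK; ring.
Qed.

Theorem mainTheorem5 (R : realType) (d N : nat) (hd : (1 <= d <= 3)%N)
  (K : mesh R d N) (hK : is_mesh K)
  (f : R -> 'rV[R]_d) (hf : C1 f)
  (gamma dt : R) (hgamma : 0 < gamma) (hdt : 0 < dt)
  (u umin umax : 'I_N -> R)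
  (hbounds : forall i : 'I_N,
     [/\ umin i <= local_min K u i,
         local_min K u i <= local_max K u i &
         local_max K u i <= umax i])
  (lam : 'I_N -> 'I_N -> R) (hlam : is_wave_speed_bound K f lam u)
  (M : nat) (hM : (1 <= M)%N) (a : 'I_M -> 'I_M -> R) (b : 'I_M -> R)
  (recon : averages R N -> pw_poly R d N)
  (Fs : antidiffusive R d N M) (hFs : is_antidiffusive K Fs)
  (y : 'I_M -> averages R N)
  (hy : is_RK_stages K f lam recon Fs dt a u y)
  (hCFL : forall i : 'I_N, (1 + gamma) * (dt * dcoef K lam i / vol K i) <= 1) :
  forall i : 'I_N,
    umin i <= limited_final_stage K f lam recon Fs dt gamma b u umin umax y i
           <= umax i.
Proof.
case: hf => df _.
have u_in i j : j \in vnbrs K i -> umin i <= u j <= umax i.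
  move=> ij; have [lo _ hi] := hbounds i; apply/andP; split.
    exact/(le_trans lo)/bigmin_le_cond.
  by apply: le_trans hi; exact: le_bigmax_cond.
have ui i : umin i <= u i <= umax i by apply: u_in; rewrite inE eqxx.
have bar i : umin i <= ubarL K f lam u i <= umax i.
  by apply: ubarL_bounds => // j; exact: u_in.
have d0 k : 0 < dcoef K lam k by exact: dcoef_gt0 hlam.
move=> i; rewrite limited_final_stageE //.
set S := \sum_(j in _) _.
have /andP[] : Qminus K f lam gamma u umin i <= S <=
    Qplus K f lam gamma u umax i.
  (* The signs of [Qminus] and [Qplus] follow because [u k] and [ubarL k] both lie in
     [[umin k, umax k]]. *)
  apply: limited_flux_sum_bounds => k.
    rewrite /Qminus pmulr_rle0 //; have := ui k; have := bar k; nra.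
  rewrite /Qplus pmulr_rge0 //; have := ui k; have := bar k; nra.
rewrite /Qminus /Qplus => loS hiS.
have r0 : 0 <= dt / vol K i by rewrite divr_ge0 // ltW // (vol_gt0 hK).
have := ler_wpM2l r0 loS; have := ler_wpM2l r0 hiS.
have := hCFL i; rewrite mulrAC => cfl.
have /andP[lo hi] := ui i.
(* The CFL condition is scaled by the distances of [u i] to its bounds. In the update [ubarL]
   cancels: [d_i * (ubarL i - u i) + Qplus i = (1 + gamma) * d_i * (umax i - u i)], and likewise for
   [Qminus]. *)
have := ler_wpM2r (_ : 0 <= u i - umin i) cfl.
have := ler_wpM2r (_ : 0 <= umax i - u i) cfl.
rewrite !subr_ge0 !mul1r => /(_ hi) chi /(_ lo) clo hS1 hS2.
by apply/andP; split; nra.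
Qed.
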